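(* Let $(\Sigma,F)$ be an orientable Finsler surface with angle form $\alpha^F$ and vertical metric $g$. Let $Y$ be the vertical vector field on $H\Sigma$ such that $\alpha^F(Y)=1$, and let $Y'$ be a vertical vector field on $H\Sigma$ with $g(Y',Y')=1$. Let $c\colon H\Sigma\to\mathbb{R}$ be the function such that $Y'=cY$. If $c$ is constant on the fibers of $H\Sigma\to\Sigma$, then $F$ is Riemannian, i.e. $F(x,\cdot)^2$ is a quadratic form on $T_x\Sigma$ for every $x\in\Sigma$.
   Context: A Finsler metric on $M$ is a continuous function $F\colon TM\to[0,\infty)$ that is $C^\infty$ off the zero section, satisfies $F(x,\lambda v)=\lambda F(x,v)$ for $\lambda>0$, satisfies $F(x,v)\ge 0$ with equality iff $v=0$, and is strongly convex: $\left(\frac{\partial^2F^2}{\partial v_i\partial v_j}\right)_{i,j}$ is positive definite (off the zero section). Let $H\Sigma=(T\Sigma\smallsetminus\{0\})/\mathbb{R}^+_*$, $r\colon T\Sigma\smallsetminus\{0\}\to H\Sigma$ and $\pi\colon H\Sigma\to\Sigma$ the projections, $VH\Sigma=\ker d\pi$; vertical vector fields are sections of $VH\Sigma$. The Hilbert form is the contact form $A_{(x,\xi)}(Z)=\lim_{\epsilon\to0}\frac{1}{\epsilon}\left(F(x,v+\epsilon\, d\pi(Z))-F(x,v)\right)$, $r(x,v)=(x,\xi)$, and $X$ is its Reeb field ($A(X)=1$, $i_XdA=0$), the generator of the geodesic flow. Angle form: $\alpha^F$ is a $1$-form on $H\Sigma$, never zero on $VH\Sigma$ (and unique there), and $\Omega^F$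 the unique volume form on $\Sigma$, with $\alpha^F\wedge\pi^*\Omega^F=A\wedge dA$ and $\int_{H_x\Sigma}\alpha^F=2\pi$ for all $x\in\Sigma$ (orientations chosen compatibly). Vertical metric: for $y_1,y_2\in V_{(x,\xi)}H\Sigma$, $g(y_1,y_2)=dA([X,Y_2],Y_1)$ where $Y_1,Y_2$ are any vertical vector fields extending $y_1,y_2$; it is a Riemannian metric on $VH\Sigma$. *)

(* Defs.v *)
(* MathComp-Analysis; the reals are an arbitrary R : realType. *)
From mathcomp Require Import all_boot all_order all_algebra.
From mathcomp Require Import all_classical all_reals all_analysis.
Import Order.TTheory GRing.Theory Num.Theory.
Import numFieldNormedType.Exports.

Set Implicit Arguments.
Unset Strict Implicit.
Unset Printing Implicit Defensive.

Local Open Scope classical_set_scope.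
Local Open Scope ring_scope.

Definition partial (R : realType) (n : nat) (i : 'I_n) (f : 'rV[R]_n -> R) :
  'rV[R]_n -> R := fun x => 'D_(delta_mx 0 i) f x.

Definition iter_partial (R : realType) (n : nat) (s : seq 'I_n)
  (f : 'rV[R]_n -> R) : 'rV[R]_n -> R := foldr (@partial R n) f s.

(* C^oo on the set U, which is open in all the uses below *)
Definition smooth_on (R : realType) (n : nat) (U : set 'rV[R]_n)
  (f : 'rV[R]_n -> R) : Prop :=
  forall (s : seq 'I_n) (x : 'rV[R]_n), U x -> differentiable (iter_partial s f) x.

Definition smooth_map_on (R : realType) (n m : nat) (U : set 'rV[R]_n)
  (f : 'rV[R]_n -> 'rV[R]_m) : Prop :=
  forall j : 'I_m, smooth_on U (fun x => f x 0 j).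

(* Charts are total functions, meaningful on chart_dom, and the local inverses
   are meaningful on chart_img. Every point p comes with a preferred chart
   chart_at p, and the tangent space at p is 'rV_n, a tangent vector being
   given by its components in the preferred chart at p; its components in an
   arbitrary chart are obtained by tcoord. *)
Record atlas (R : realType) (n : nat) (M : Type) := Atlas {
  chart_idx : Type;
  chart_dom : chart_idx -> set M;
  chart : chart_idx -> M -> 'rV[R]_n;
  chart_inv : chart_idx -> 'rV[R]_n -> M;
  chart_at : M -> chart_idx }.

Definition chart_img (R : realType) (n : nat) (M : Type) (a : atlas R n M)
  (c : chart_idx a) : set 'rV[R]_n := chart c @` chart_dom c.

Record smooth_manifold (R : realType) (n : nat) (M : topologicalType)
  (a : atlas R n M) : Prop := SmoothManifold {
  sm_hausdorff : hausdorff_space M;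
  sm_countable : @second_countable M;
  sm_cover : forall p : M, chart_dom (chart_at a p) p;
  sm_dom_open : forall c : chart_idx a, open (chart_dom c);
  sm_img_open : forall c : chart_idx a, open (chart_img c);
  sm_invK : forall (c : chart_idx a) (p : M),
    chart_dom c p -> chart_inv c (chart c p) = p;
  sm_continuous : forall c : chart_idx a,
    {within chart_dom c, continuous (chart c)};
  sm_inv_continuous : forall c : chart_idx a,
    {within chart_img c, continuous (chart_inv c)};
  sm_transition : forall c d : chart_idx a,
    smooth_map_on (chart c @` (chart_dom c `&` chart_dom d))
                  (chart d \o chart_inv c) }.

Section Manifold.
Variables (R : realType) (n : nat) (M : Type) (a : atlas R n M).

Definition tcoord (c : chart_idx a) (p : M) (v : 'rV[R]_n) : 'rV[R]_n :=
  'd (chart c \o chart_inv (chart_at a p)) (chart (chart_at a p) p) v.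

Definition tvec (c : chart_idx a) (p : M) (w : 'rV[R]_n) : 'rV[R]_n :=
  'd (chart (chart_at a p) \o chart_inv c) (chart c p) w.

Definition smooth_fun_on (U : set M) (f : M -> R) : Prop :=
  forall c : chart_idx a,
    smooth_on (chart c @` (chart_dom c `&` U)) (f \o chart_inv c).

(* continuity for the topology in which the charts are homeomorphisms *)
Definition continuous_fun (f : M -> R) : Prop :=
  forall (c : chart_idx a) (y : 'rV[R]_n), chart_img c y ->
    {for y, continuous (f \o chart_inv c)}.

Definition vf_rep (X : M -> 'rV[R]_n) (c : chart_idx a) (y : 'rV[R]_n) :
  'rV[R]_n := tcoord c (chart_inv c y) (X (chart_inv c y)).

Definition smooth_vf (X : M -> 'rV[R]_n) : Prop :=
  forall c : chart_idx a, smooth_map_on (chart_img c) (vf_rep X c).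

Definition lie_bracket (X Y : M -> 'rV[R]_n) (p : M) : 'rV[R]_n :=
  let c := chart_at a p in
  'D_(X p) (vf_rep Y c) (chart c p) - 'D_(Y p) (vf_rep X c) (chart c p).

Definition form1_rep (A : M -> 'rV[R]_n -> R) (c : chart_idx a)
  (w : 'rV[R]_n) (y : 'rV[R]_n) : R :=
  A (chart_inv c y) (tvec c (chart_inv c y) w).

Definition smooth_form1 (A : M -> 'rV[R]_n -> R) : Prop :=
  (forall (p : M) (k : R) (u v : 'rV[R]_n),
     A p (k *: u + v) = k * A p u + A p v) /\
  (forall (c : chart_idx a) (w : 'rV[R]_n),
     smooth_on (chart_img c) (form1_rep A c w)).

Definition smooth_form2 (B : M -> 'rV[R]_n -> 'rV[R]_n -> R) : Prop :=
  [/\ forall (p : M) (k : R) (u v w : 'rV[R]_n),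
        B p (k *: u + v) w = k * B p u w + B p v w,
      forall (p : M) (u v : 'rV[R]_n), B p u v = - B p v u &
      forall (c : chart_idx a) (u v : 'rV[R]_n),
        smooth_on (chart_img c)
          (fun y => B (chart_inv c y) (tvec c (chart_inv c y) u)
                                      (tvec c (chart_inv c y) v))].

(* dA(U,V) = U(A(V)) - V(A(U)) - A([U,V]) (no factor 1/2), evaluated on the
   coordinate fields of the preferred chart at p, which commute *)
Definition ext_deriv (A : M -> 'rV[R]_n -> R) (p : M) (u v : 'rV[R]_n) : R :=
  let c := chart_at a p in
  'D_u (form1_rep A c v) (chart c p) - 'D_v (form1_rep A c u) (chart c p).

Definition velocity (gamma : R -> M) (t : R) : 'rV[R]_n :=
  derive1 (chart (chart_at a (gamma t)) \o gamma) t.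

Definition line_integral (A : M -> 'rV[R]_n -> R) (gamma : R -> M)
  (t0 t1 : R) : R :=
  \int[lebesgue_measure]_(t in `[t0, t1]) A (gamma t) (velocity gamma t).

End Manifold.

Definition wedge12 (R : realType) (n : nat) (M : Type)
  (A : M -> 'rV[R]_n -> R) (B : M -> 'rV[R]_n -> 'rV[R]_n -> R)
  (p : M) (u v w : 'rV[R]_n) : R :=
  A p u * B p v w - A p v * B p u w + A p w * B p u v.

Definition tangent_map (R : realType) (n m : nat) (M N : Type)
  (a : atlas R n M) (b : atlas R m N) (f : M -> N) (p : M) (v : 'rV[R]_n) :
  'rV[R]_m :=
  'd (chart (chart_at b (f p)) \o f \o chart_inv (chart_at a p))
     (chart (chart_at a p) p) v.

Definition pullback2 (R : realType) (n m : nat) (M N : Type)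
  (a : atlas R n M) (b : atlas R m N) (f : M -> N)
  (B : N -> 'rV[R]_m -> 'rV[R]_m -> R) (p : M) (u v : 'rV[R]_n) : R :=
  B (f p) (tangent_map a b f p u) (tangent_map a b f p v).

Definition tangent_atlas (R : realType) (n : nat) (M : Type)
  (a : atlas R n M) : atlas R (n + n) (M * 'rV[R]_n) :=
  @Atlas R (n + n) (M * 'rV[R]_n) (chart_idx a)
    (fun c => [set z | chart_dom c z.1])
    (fun c z => row_mx (chart c z.1) (tcoord c z.1 z.2))
    (fun c y => let p := chart_inv c (lsubmx y) in (p, tvec c p (rsubmx y)))
    (fun z => chart_at a z.1).

(* o p = true means that the preferred chart at p is positive at p; the
   orientation is coherent when the sign of every chart is locally constant. *)
Definition positive_chart (R : realType) (n : nat) (M : Type)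
  (a : atlas R n M) (o : M -> bool) (c : chart_idx a) (q : M) : bool :=
  0 < (if o q then 1 else -1) *
      \det ('J (chart c \o chart_inv (chart_at a q)) (chart (chart_at a q) q)).

Definition orientation (R : realType) (n : nat) (M : topologicalType)
  (a : atlas R n M) (o : M -> bool) : Prop :=
  forall (c : chart_idx a) (p : M), chart_dom c p ->
    \forall q \near p, positive_chart o c q = positive_chart o c p.

Definition posdef (R : realType) (n : nat) (B : 'M[R]_n) : Prop :=
  forall u : 'rV[R]_n, u != 0 -> 0 < (u *m B *m u^T) 0 0.

Definition hessian (R : realType) (n : nat) (f : 'rV[R]_n -> R)
  (v : 'rV[R]_n) : 'M[R]_n := \matrix_(i, j) partial i (partial j f) v.

Record finsler_metric (R : realType) (n : nat) (M : Type) (a : atlas R n M)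
  (F : M -> 'rV[R]_n -> R) : Prop := FinslerMetric {
  fm_continuous : continuous_fun (tangent_atlas a) (fun z => F z.1 z.2);
  fm_smooth : smooth_fun_on (tangent_atlas a) [set z | z.2 != 0]
                            (fun z => F z.1 z.2);
  fm_homogeneous : forall (x : M) (l : R) (v : 'rV[R]_n),
    0 < l -> F x (l *: v) = l * F x v;
  fm_ge0 : forall (x : M) (v : 'rV[R]_n), 0 <= F x v;
  fm_eq0 : forall (x : M) (v : 'rV[R]_n), F x v = 0 <-> v = 0;
  fm_convex : forall (x : M) (v : 'rV[R]_n),
    v != 0 -> posdef (hessian (fun w => F x w ^+ 2) v) }.

Definition riemannian (R : realType) (n : nat) (M : Type)
  (F : M -> 'rV[R]_n -> R) : Prop :=
  forall x : M, exists B : 'M[R]_n,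
    forall v : 'rV[R]_n, F x v ^+ 2 = (v *m B *m v^T) 0 0.

Section HomogenizedBundle.
Variables (R : realType) (S : Type) (a : atlas R 2 S).

Definition ray (v : 'rV[R]_2) : set 'rV[R]_2 :=
  [set t *: v | t in [set t : R | 0 < t]].

(* (TS \ 0) / R+*, as the set of the orbits *)
Definition HS : Type :=
  {h : S * set 'rV[R]_2 | exists2 v : 'rV[R]_2, v != 0 & h.2 = ray v}.

Definition Hproj (h : HS) : S := (sval h).1.

(* a representative of the class h, i.e. r (Hproj h, Hdir h) = h *)
Definition Hdir (h : HS) : 'rV[R]_2 := sval (cid2 (svalP h)).

Lemma ray_class (x : S) (v : 'rV[R]_2) : v != 0 ->
  exists2 w : 'rV[R]_2, w != 0 & (x, ray v).2 = ray w.
Proof. by move=> v0; exists v. Qed.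

Lemma delta00_neq0 : (delta_mx 0 0 : 'rV[R]_2) != 0.
Proof.
by apply/eqP => /matrixP /(_ 0 0); rewrite !mxE !eqxx => /eqP; rewrite oner_eq0.
Qed.

(* the projection r; the value at v = 0 is irrelevant *)
Definition Hclass (x : S) (v : 'rV[R]_2) : HS :=
  if pselect (v != 0) is left v0 then exist _ (x, ray v) (ray_class x v0)
  else exist _ (x, ray (delta_mx 0 0)) (ray_class x delta00_neq0).

(* A chart c of S, i : 'I_2 and a sign s give a chart of the open set of the
   classes of (x, v) with (-1)^s w_i > 0, where w are the components of v in c:
   the coordinates are those of x in c and the other component of w, when w is
   normalized by (-1)^s w_i = 1. *)
Definition H_atlas : atlas R (2 + 1) HS :=
  @Atlas R (2 + 1) HS (chart_idx a * 'I_2 * bool)%type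
    (fun k => [set h | chart_dom k.1.1 (Hproj h) /\
       0 < (-1) ^+ k.2 * tcoord k.1.1 (Hproj h) (Hdir h) 0 k.1.2])
    (fun k h =>
       let w := tcoord k.1.1 (Hproj h) (Hdir h) in
       row_mx (chart k.1.1 (Hproj h))
              (const_mx (w 0 (rev_ord k.1.2) / ((-1) ^+ k.2 * w 0 k.1.2))))
    (fun k y =>
       let x := chart_inv k.1.1 (lsubmx y) in
       Hclass x (tvec k.1.1 x
         (\row_j (if j == k.1.2 then (-1) ^+ k.2 else rsubmx y 0 0))))
    (fun h =>
       let i : 'I_2 := if Hdir h 0 0 == 0 then ord_max else ord0 in
       (chart_at a (Hproj h), i, Hdir h 0 i < 0)).

Definition vertical (h : HS) (y : 'rV[R]_(2 + 1)) : Prop :=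
  tangent_map H_atlas a Hproj h y = 0.

Definition vertical_field (Y : HS -> 'rV[R]_(2 + 1)) : Prop :=
  smooth_vf H_atlas Y /\ forall h : HS, vertical h (Y h).

(* lim_(e -> 0) (F(x, v + e dpi(Z)) - F(x, v)) / e, with r (x, v) = h *)
Definition hilbert_form (F : S -> 'rV[R]_2 -> R) (h : HS)
  (Z : 'rV[R]_(2 + 1)) : R :=
  'D_(tangent_map H_atlas a Hproj h Z) (F (Hproj h)) (Hdir h).

Definition reeb_field (F : S -> 'rV[R]_2 -> R) (X : HS -> 'rV[R]_(2 + 1)) :
  Prop :=
  [/\ smooth_vf H_atlas X,
      forall h : HS, hilbert_form F h (X h) = 1 &
      forall (h : HS) (Z : 'rV[R]_(2 + 1)),
        ext_deriv H_atlas (hilbert_form F) h (X h) Z = 0].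

(* the circle H_x S, run once in the direction given by the orientation of S *)
Definition fiber_loop (o : S -> bool) (x : S) (t : R) : HS :=
  Hclass x (\row_j (if j == 0 then cos t
                    else if o x then sin t else - sin t)).

Definition volume_form2 (Om : S -> 'rV[R]_2 -> 'rV[R]_2 -> R) : Prop :=
  smooth_form2 a Om /\
  forall x : S, exists u v : 'rV[R]_2, Om x u v != 0.

(* The fibers carry the orientation induced by o, so that alpha is positive on
   them; the orientation defined by the volume form Om is then dictated by
   alpha /\ pi^* Om = A /\ dA and is not constrained otherwise. *)
Record angle_form (o : S -> bool) (F : S -> 'rV[R]_2 -> R)
  (alpha : HS -> 'rV[R]_(2 + 1) -> R)
  (Om : S -> 'rV[R]_2 -> 'rV[R]_2 -> R) : Prop := AngleForm {
  af_form : smooth_form1 H_atlas alpha;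
  af_volume : volume_form2 Om;
  af_vertical : forall (h : HS) (y : 'rV[R]_(2 + 1)),
    vertical h y -> y != 0 -> alpha h y != 0;
  af_wedge : forall (h : HS) (u v w : 'rV[R]_(2 + 1)),
    wedge12 alpha (pullback2 H_atlas a Hproj Om) h u v w =
    wedge12 (hilbert_form F) (ext_deriv H_atlas (hilbert_form F)) h u v w;
  af_integral : forall x : S,
    line_integral H_atlas alpha (fiber_loop o x) 0 (2 * pi) = 2 * pi }.

(* g is only specified on vertical vectors *)
Definition vertical_metric (F : S -> 'rV[R]_2 -> R)
  (X : HS -> 'rV[R]_(2 + 1))
  (g : HS -> 'rV[R]_(2 + 1) -> 'rV[R]_(2 + 1) -> R) : Prop :=
  forall (h : HS) (y1 y2 : 'rV[R]_(2 + 1)), vertical h y1 -> vertical h y2 ->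
  forall Y1 Y2 : HS -> 'rV[R]_(2 + 1),
    vertical_field Y1 -> vertical_field Y2 -> Y1 h = y1 -> Y2 h = y2 ->
    g h y1 y2 =
    ext_deriv H_atlas (hilbert_form F) h (lie_bracket H_atlas X Y2 h) (Y1 h).

End HomogenizedBundle.

(* Main.v *)
Require Import Defs.
From mathcomp Require Import all_boot all_order all_algebra.
From mathcomp Require Import all_classical all_reals all_analysis.
From mathcomp Require Import ring lra.
Import Order.TTheory GRing.Theory Num.Theory.
Import numFieldNormedType.Exports.
Local Open Scope classical_set_scope.
Local Open Scope ring_scope.

Set Implicit Arguments.
Unset Strict Implicit.
Unset Printing Implicit Defensive.

(* Fix x and a sign e = +-1, and let f(s) = F(x, (e, s)) in the preferred chart
   at x.  In the coordinates (x_1, x_2, s) of HS, the horizontal part of the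
   Reeb field is (e, s) / f, and with w = Om(d_1, d_2) the defining relations of
   the angle form and of the vertical metric become
     alpha(d_s) w = - e f f'',    g(d_s, d_s) = f'' / f.
   Hence Y' = c Y is g-unitary iff f^3 f'' = (c w)^2, which is constant in s
   when c is constant on the fibers.  Differentiating gives (f^2)''' = 0, so
   F(x, .)^2 is a quadratic form on each of the half-planes v_1 > 0 and v_1 < 0;
   the two forms agree because F(x, .)^2 is smooth across v_1 = 0.
   Only derivatives along the fibers have to be computed: horizontal derivatives
   only hit components that vanish identically. *)

(** * Differentials as local objects, derivatives along lines, and two one-variable integrations *)

Section Calculus.
Context {R : realType}.

(* [diff] is a choice operator whose default is the zero map. *)
Lemma diff_default (V W : normedModType R) (f : V -> W) (x v : V) :
  ~ differentiable f x -> 'd f x v = 0.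
Proof.
move=> ndf; rewrite /diff getPN // => df [dfc fE]; apply: ndf; apply/diffP.
apply: (@getPex _ (fun df : {linear V -> W} => continuous df /\
  forall y, f y = f (lim (nbhs x)) + df (y - lim (nbhs x))
                  +o_(y \near x) (y - lim (nbhs x)))).
by exists df.
Qed.

(** The first-order expansion of [f] at [x] is also one of [g], and the continuous linear part of
    such an expansion is unique. *)
Lemma near_eq_diff (V W : normedModType R) (f g : V -> W) (x : V) :
  (\near x, f x = g x) -> differentiable f x ->
  differentiable g x /\ 'd g x = 'd f x :> (V -> W).
Proof.
move=> fg df.
have gE : g \o shift x = cst (g x) + 'd f x +o_ 0 id.
  apply/eqaddoP => e e0; have /diff_locally/eqaddoP/(_ e e0) fo := df.
  have fg0 : \forall y \near 0, f (y + x) = g (y + x).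
    by move: fg; rewrite (near_shift 0 x) subr0.
  near=> y; have fgy : f (y + x) = g (y + x) by near: y.
  have /= : `|(f \o shift x - (cst (f x) + 'd f x)) y| <= e * `|y| by near: y.
  by rewrite /= !fctE /= fgy (nbhs_singleton fg).
have [dfc _] := (diff_locallyP x f).1 df.
have dgE : 'd g x = 'd f x :> (V -> W) by exact: diff_unique.
by split=> //; apply/diff_locallyP; rewrite dgE.
Unshelve. all: by end_near. Qed.

(** The two difference quotients are the same function, so the equality holds whether or not the
    derivative exists. *)
Lemma derive_along (V W : normedModType R) (f : V -> W) (x v : V) (t : R) :
  'D_1 (fun t : R => f (x + t *: v)) t = 'D_v f (x + t *: v).
Proof.
set g := fun t : R => _; rewrite /derive; set d := fun _ => _; set d' := fun _ => _.
suff -> : d = d' by [].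
by apply/funext => h; rewrite /d /d' /g /= [h%:A]mulr1 scalerDl addrCA.
Qed.

Lemma derivable_along (V W : normedModType R) (f : V -> W) (x v : V) (t : R) :
  derivable (fun t : R => f (x + t *: v)) t 1 = derivable f (x + t *: v) v.
Proof.
set g := fun t : R => _; rewrite /derivable; set d := fun _ => _; set d' := fun _ => _.
suff -> : d = d' by [].
by apply/funext => h; rewrite /d /d' /g /= [h%:A]mulr1 scalerDl addrCA.
Qed.

Lemma is_derive_along (V W : normedModType R) (f : V -> W) (x v : V) (t : R) :
  differentiable f (x + t *: v) ->
  is_derive t (1 : R) (fun t : R => f (x + t *: v)) ('D_v f (x + t *: v)).
Proof.
move=> df; apply: DeriveDef; last exact: derive_along.
by rewrite derivable_along; exact: diff_derivable.
Qed.

Lemma differentiable_row (V : normedModType R) n (f : V -> 'rV[R]_n) x :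
  (forall j, differentiable (fun y => f y 0 j) x) -> differentiable f x.
Proof.
move=> df.
have -> : f = \sum_(j < n) (fun y => f y 0 j *: delta_mx 0 j).
  by apply/funext => y; rewrite fct_sumE {1}[f y]row_sum_delta.
by apply: differentiable_sum => j; apply: differentiableZl.
Qed.

Lemma quadratic_of_derive2 (g g1 : R -> R) (c : R) :
  (forall s, is_derive s (1 : R) g (g1 s)) -> (forall s, is_derive s (1 : R) g1 c) ->
  exists b e, forall s, g s = c / 2 * s ^+ 2 + b * s + e.
Proof.
move=> dg dg1.
have g1E s : g1 s = c * s + g1 0.
  have dh t : is_derive t (1 : R) (fun t => g1 t - c * t) 0.
    by apply: is_derive_eq; rewrite [_ *: _]mulr1 subrr.
  have := is_derive_0_is_cst s 0 dh; rewrite mulr0 subr0 => <-; ring.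
exists (g1 0), (g 0) => s.
have dh t : is_derive t (1 : R) (fun t => g t - (c / 2 * (t * t) + g1 0 * t)) 0.
  by apply: is_derive_eq; rewrite g1E /GRing.scale /=; field.
have := is_derive_0_is_cst s 0 dh; rewrite !mulr0 addr0 subr0 => <-; ring.
Qed.

(* Differentiating [f^3 f'' = K] gives [f f''' + 3 f' f'' = 0], and
   [2 (f f''' + 3 f' f'')] is the third derivative of [f^2]. *)
Lemma sqr_quadratic (f f1 f2 f3 : R -> R) (K : R) :
  (forall s, is_derive s (1 : R) f (f1 s)) -> (forall s, is_derive s (1 : R) f1 (f2 s)) ->
  (forall s, is_derive s (1 : R) f2 (f3 s)) -> (forall s, 0 < f s) ->
  (forall s, f s ^+ 3 * f2 s = K) ->
  exists a b e, forall s, f s ^+ 2 = a * s ^+ 2 + b * s + e.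
Proof.
move=> d1 d2 d3 f0 fK.
have E s : f s * f3 s = - 3 * (f1 s * f2 s).
  have dK' : is_derive s (1 : R) (fun s => f s * (f s * (f s * f2 s)))
      (f s ^+ 2 * (f s * f3 s + 3 * (f1 s * f2 s))).
    by apply: is_derive_eq; rewrite /GRing.scale /=; ring.
  have dK : is_derive s (1 : R) (fun s => f s * (f s * (f s * f2 s))) 0.
    rewrite (_ : (fun _ => _) = cst K); first exact: is_derive_cst.
    by apply/funext => t; rewrite -(fK t) /cst; ring.
  have := @derive_val _ _ _ _ _ _ _ dK; rewrite (@derive_val _ _ _ _ _ _ _ dK').
  move/eqP; rewrite mulf_eq0 sqrf_eq0 (gt_eqF (f0 s)) /= addr_eq0 => /eqP ->; ring.
have dg s : is_derive s (1 : R) (fun s => f s * f s) (2 * (f s * f1 s)).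
  by apply: is_derive_eq; rewrite /GRing.scale /=; ring.
have dg1 s : is_derive s (1 : R) (fun s => 2 * (f s * f1 s))
    (2 * (f1 s * f1 s + f s * f2 s)).
  by apply: is_derive_eq; rewrite /GRing.scale /=; ring.
have dg2 s : is_derive s (1 : R) (fun s => 2 * (f1 s * f1 s + f s * f2 s)) 0.
  by apply: is_derive_eq; rewrite /GRing.scale /= E; ring.
have g2E s := is_derive_0_is_cst s 0 dg2.
have [] := @quadratic_of_derive2 _ _ (2 * (f1 0 * f1 0 + f 0 * f2 0)) dg.
  by move=> s; rewrite -(g2E s).
by move=> b [e fE]; do 3!eexists; move=> s; rewrite [LHS]expr2 fE.
Qed.

End Calculus.

(** * Minkowski norms solving f^3 f'' = K on two half-planes *)

Section Gluing.
Context {R : realType}.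

Lemma near_halfline (b : bool) (t : R) :
  0 < (-1) ^+ b * t -> \forall u \near t, 0 < (-1) ^+ b * u.
Proof.
move=> t0; have : {for t, continuous (fun u : R => (-1) ^+ b * u)}.
  by apply: differentiable_continuous; exact/derivable1_diffP.
by move/cvgr_gt; apply.
Qed.

(** The points [(-1) ^+ b / (n + 1)] stay in the half-line and tend to 0, so [h 0] and [k 0] are
    limits of one and the same sequence. *)
Lemma eq0_halfline (b : bool) (h k : R -> R) :
  {for 0, continuous h} -> {for 0, continuous k} ->
  (forall t, 0 < (-1) ^+ b * t -> h t = k t) -> h 0 = k 0.
Proof.
move=> ch ck hk; pose u n := (-1) ^+ b * harmonic n : R.
have u0 : u @ \oo --> (0 : R).
  rewrite -[X in _ --> X](mulr0 ((-1) ^+ b)).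
  by apply: cvgM; [exact: cvg_cst|exact: cvg_harmonic].
have hu : (h \o u) @ \oo --> h 0 by apply: cvg_comp u0 ch.
have ku : (k \o u) @ \oo --> k 0 by apply: cvg_comp u0 ck.
apply: (cvg_unique _ hu); rewrite //= (_ : h \o u = k \o u) //.
apply/funext => n; apply: hk.
by rewrite /u mulrA -expr2 sqrr_sign mul1r /harmonic /= invr_gt0.
Qed.

Lemma derive2_halfline (g g1 g2 : R -> R) (b : bool) (p q r : R) :
  (forall s, is_derive s (1 : R) g (g1 s)) ->
  (forall s, is_derive s (1 : R) g1 (g2 s)) ->
  (forall t, 0 < (-1) ^+ b * t -> g t = p * t ^+ 2 + q * t + r) ->
  forall t, 0 < (-1) ^+ b * t -> g2 t = 2 * p.
Proof.
move=> dg dg1 gE.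
have g1E t : 0 < (-1) ^+ b * t -> g1 t = 2 * p * t + q.
  move=> t0; rewrite -[LHS](@derive_val _ _ _ _ _ _ _ (dg t)).
  rewrite (@near_eq_derive _ _ _ g (fun t => p * (t * t) + q * t + r)).
    by rewrite derive_val /GRing.scale /=; ring.
  by near=> u; rewrite gE ?expr2 //; near: u; exact: near_halfline.
move=> t t0; rewrite -[LHS](@derive_val _ _ _ _ _ _ _ (dg1 t)).
rewrite (@near_eq_derive _ _ _ g1 (fun t => 2 * p * t + q)).
  by rewrite derive_val /GRing.scale /=; ring.
by near=> u; rewrite g1E //; near: u; exact: near_halfline.
Unshelve. all: by end_near. Qed.

Definition vec (x y : R) : 'rV[R]_2 := \row_j (if j == 0 then x else y).

Lemma vecZ l x y : l *: vec x y = vec (l * x) (l * y).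
Proof. by apply/rowP => j; rewrite !mxE; case: ifP. Qed.

Lemma vecD x y x' y' : vec x y + vec x' y' = vec (x + x') (y + y').
Proof. by apply/rowP => j; rewrite !mxE; case: ifP. Qed.

Lemma vec_eta (v : 'rV[R]_2) : v = vec (v 0 0) (v 0 1).
Proof.
apply/rowP => j; rewrite mxE; case: ifP => [/eqP -> //|].
by case: j => -[|[|//]] // i _; congr (v _ _); apply/val_inj.
Qed.

Lemma delta_vec0 : delta_mx 0 0 = vec 1 0.
Proof. by apply/rowP => -[[|[|//]] i]; rewrite !mxE. Qed.

Lemma delta_vec1 : delta_mx 0 1 = vec 0 1.
Proof. by apply/rowP => -[[|[|//]] i]; rewrite !mxE. Qed.

Lemma vec_eq0 x y : (vec x y == 0) = (x == 0) && (y == 0).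
Proof.
apply/eqP/andP => [/rowP v0|[/eqP -> /eqP ->]].
  by move: (v0 0) (v0 1); rewrite !mxE /= => -> ->.
by apply/rowP => j; rewrite !mxE if_same.
Qed.

Lemma vec_neq0l b y : vec ((-1) ^+ b) y != 0.
Proof. by rewrite vec_eq0 signr_eq0. Qed.

Lemma is_derive_vecr (f : 'rV[R]_2 -> R) (x y : R) :
  differentiable f (vec x y) ->
  is_derive y (1 : R) (fun y => f (vec x y)) (partial 1 f (vec x y)).
Proof.
have E t : vec x t = vec x 0 + t *: delta_mx 0 1.
  by rewrite delta_vec1 vecZ vecD mulr0 mulr1 addr0 add0r.
rewrite /partial E => /is_derive_along.
by rewrite (_ : (fun y => f (vec x y)) = fun t => f (vec x 0 + t *: delta_mx 0 1)) //;
  apply/funext => t; rewrite E.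
Qed.

Lemma is_derive_vecl (f : 'rV[R]_2 -> R) (x y : R) :
  differentiable f (vec x y) ->
  is_derive x (1 : R) (fun x => f (vec x y)) (partial 0 f (vec x y)).
Proof.
have E t : vec t y = vec 0 y + t *: delta_mx 0 0.
  by rewrite delta_vec0 vecZ vecD mulr0 mulr1 addr0 add0r.
rewrite /partial E => /is_derive_along.
by rewrite (_ : (fun x => f (vec x y)) = fun t => f (vec 0 y + t *: delta_mx 0 0)) //;
  apply/funext => t; rewrite E.
Qed.

Section Norm.
Variables (N : 'rV[R]_2 -> R) (K : bool -> R).
Hypothesis N_homo : forall l v, 0 < l -> N (l *: v) = l * N v.
Hypothesis N_eq0 : N 0 = 0.
Hypothesis N_gt0 : forall v, v != 0 -> 0 < N v.
Hypothesis N_smooth : smooth_on [set v | v != 0] N.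
Hypothesis N_ode : forall (b : bool) s, N (vec ((-1) ^+ b) s) ^+ 3 *
  partial 1 (partial 1 N) (vec ((-1) ^+ b) s) = K b.

(** On the line where the first coordinate is [(-1) ^+ b], the equation makes the square of [N] a
    quadratic polynomial in [s]. Homogeneity spreads it over the half-plane, with [l = |x|] and
    [s = y / l]. *)
Lemma halfplane_quadratic (b : bool) : exists p q r, forall x y,
  0 < (-1) ^+ b * x -> N (vec x y) ^+ 2 = p * x ^+ 2 + q * x * y + r * y ^+ 2.
Proof.
have vn0 s : [set v : 'rV[R]_2 | v != 0] (vec ((-1) ^+ b) s) by exact: vec_neq0l.
have [] := @sqr_quadratic R (fun s => N (vec ((-1) ^+ b) s)) _ _ _ (K b)
  (fun s => is_derive_vecr (N_smooth [::] (vn0 s)))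
  (fun s => is_derive_vecr (N_smooth [:: 1] (vn0 s)))
  (fun s => is_derive_vecr (N_smooth [:: 1; 1] (vn0 s))).
- by move=> s; apply: N_gt0; exact: vec_neq0l.
- by move=> s; exact: N_ode.
(* After multiplication by [l ^+ 2] the constant term becomes the coefficient of [x ^+ 2] and the
   leading one that of [y ^+ 2]. The middle term is [q * l * y], and [l] is [(-1) ^+ b * x]. *)
move=> p [q [r fE]]; exists r, ((-1) ^+ b * q), p => x y x0.
set l := (-1) ^+ b * x in x0.
have xl : x = l * (-1) ^+ b by rewrite mulrC mulrA -expr2 sqrr_sign mul1r.
have -> : vec x y = l *: vec ((-1) ^+ b) (y / l).
  by rewrite vecZ -xl mulrC divfK // gt_eqF.
rewrite N_homo // exprMn fE {1 2}xl.
have s2 : (-1 : R) ^+ b ^+ 2 = 1 by exact: sqrr_sign.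
move: ((-1) ^+ b) s2 => e s2.
have -> : (l * e) ^+ 2 = l ^+ 2 by rewrite exprMn s2 mulr1.
have -> : e * q * (l * e) = e ^+ 2 * (q * l) by ring.
by rewrite s2; field; rewrite gt_eqF.
Qed.

(** The line [y = 1] crosses both half-planes away from the origin. There the square of [N] has
    second derivative [2 * p] on one side and [2 * p'] on the other; continuity at 0 identifies
    them, so a single polynomial covers the whole line and forces the two forms to coincide. *)
Lemma norm_quadratic : exists p q r, forall x y,
  N (vec x y) ^+ 2 = p * x ^+ 2 + q * x * y + r * y ^+ 2.
Proof.
have [p [q [r E]]] := halfplane_quadratic false.
have [p' [q' [r' E']]] := halfplane_quadratic true.
have vn0 t : [set v : 'rV[R]_2 | v != 0] (vec t 1).
  by rewrite /= vec_eq0 oner_eq0 andbF.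
pose f t := N (vec t 1); pose f1 t := partial 0 N (vec t 1).
(* The third derivative [f3] serves to make [f2], hence [g2], continuous at 0. *)
pose f2 t := partial 0 (partial 0 N) (vec t 1).
pose f3 t := partial 0 (partial 0 (partial 0 N)) (vec t 1).
have d1 t : is_derive t (1 : R) f (f1 t) := is_derive_vecl (N_smooth [::] (vn0 t)).
have d2 t : is_derive t (1 : R) f1 (f2 t) := is_derive_vecl (N_smooth [:: 0] (vn0 t)).
have d3 t : is_derive t (1 : R) f2 (f3 t) := is_derive_vecl (N_smooth [:: 0; 0] (vn0 t)).
pose g t := f t * f t; pose g1 t := 2 * (f t * f1 t).
pose g2 t := 2 * (f1 t * f1 t + f t * f2 t).
have dg s : is_derive s (1 : R) g (g1 s).
  by apply: is_derive_eq; rewrite /g1 /GRing.scale /=; ring.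
have dg1 s : is_derive s (1 : R) g1 (g2 s).
  by apply: is_derive_eq; rewrite /g2 /GRing.scale /=; ring.
have cg2 : {for 0, continuous g2}.
  by apply: differentiable_continuous; exact/derivable1_diffP.
have g2E : forall t, 0 < t -> g2 t = 2 * p.
  move=> t t0; apply: (@derive2_halfline g g1 g2 false p q r) => //;
    last by rewrite mul1r.
  by move=> u u0; rewrite -[LHS]expr2 E //; ring.
have g2E' : forall t, t < 0 -> g2 t = 2 * p'.
  move=> t t0; apply: (@derive2_halfline g g1 g2 true p' q' r') => //;
    last by rewrite mulN1r oppr_gt0.
  by move=> u u0; rewrite -[LHS]expr2 E' //; ring.
have g20 : g2 0 = 2 * p.
  apply: (@eq0_halfline false g2 (cst (2 * p))) => //; first exact: cst_continuous.
  by move=> t; rewrite mul1r; exact: g2E.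
have g20' : g2 0 = 2 * p'.
  apply: (@eq0_halfline true g2 (cst (2 * p'))) => //; first exact: cst_continuous.
  by move=> t; rewrite mulN1r oppr_gt0; exact: g2E'.
have pp' : p' = p by lra.
have g2p t : g2 t = 2 * p.
  by have [/g2E'|/g2E|->] := ltgtP t 0; rewrite ?pp'.
have [s|b [e gE]] := @quadratic_of_derive2 _ g g1 (2 * p) dg.
  by rewrite -(g2p s).
have gE1 t : 0 < t -> g t = p * t ^+ 2 + q * t + r.
  by move=> t0; rewrite -[LHS]expr2 E ?mul1r //; ring.
have gE2 t : 0 < t -> g (- t) = p' * t ^+ 2 - q' * t + r'.
  by move=> t0; rewrite -[LHS]expr2 E' ?mulN1r ?opprK //; ring.
(* The leading coefficient being known, two points on each side of 0 determine the other two
   coefficients of [g]. *)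
have [qq' rr'] : q' = q /\ r' = r.
  have := gE1 1 ltr01; have := gE1 2 (ltr0n _ _).
  have := gE2 1 ltr01; have := gE2 2 (ltr0n _ _).
  by rewrite !gE pp'; split; lra.
have En0 x y : x != 0 -> N (vec x y) ^+ 2 = p * x ^+ 2 + q * x * y + r * y ^+ 2.
  case/lt_total/orP => x0; last by rewrite E // mul1r.
  by rewrite E' ?pp' ?qq' ?rr' // mulN1r oppr_gt0.
exists p, q, r => x y; have [->{x}|/En0//] := eqVneq x 0.
have [->|y0] := eqVneq y 0.
  have -> : vec 0 0 = 0 by apply/eqP; rewrite vec_eq0 eqxx.
  by rewrite N_eq0; ring.
have dN : is_derive (0 : R) (1 : R) (fun x => N (vec x y)) (partial 0 N (vec 0 y)).
  by apply: is_derive_vecl; apply: (N_smooth [::]); rewrite /= vec_eq0 (negPf y0) andbF.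
(* On the axis [x = 0] away from the origin, both sides are continuous in [x] and agree for
   [x > 0]. *)
apply: (@eq0_halfline false (fun x => N (vec x y) ^+ 2)
  (fun x => p * x ^+ 2 + q * x * y + r * y ^+ 2)).
- by apply: differentiable_continuous; exact/derivable1_diffP.
- by apply: differentiable_continuous; exact/derivable1_diffP.
- by move=> t; rewrite mul1r => t0; rewrite En0 // gt_eqF.
Qed.

Lemma norm_quadratic_form :
  exists B : 'M[R]_2, forall v, N v ^+ 2 = (v *m B *m v^T) 0 0.
Proof.
have [p [q [r E]]] := norm_quadratic.
exists (\matrix_(i, j) if (i == 0) && (j == 0) then p
                       else if (i == 1) && (j == 1) then r else q / 2) => v.
rewrite {1}[v]vec_eta E !mxE !big_ord_recl big_ord0 /= !mxE.
rewrite !big_ord_recl !big_ord0 /= !mxE /=.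
have -> : lift ord0 ord0 = 1 :> 'I_2 by exact/val_inj.
by rewrite /=; field.
Qed.

End Norm.
End Gluing.

(** * Smooth manifolds *)

Lemma diff_near_id (R : realType) (V : normedModType R) (f : V -> V) (x w : V) :
  (\near x, f x = x) -> 'd f x w = w.
Proof.
move=> fx; have xf : \near x, id x = f x by apply: filterS fx => y ->.
have [_ ->] := near_eq_diff xf (ex_diff : differentiable id x).
by rewrite diff_val.
Qed.

Section Charts.
Context {R : realType} (n : nat) (M : topologicalType) (a : atlas R n M).
Hypothesis hM : smooth_manifold a.

Lemma near_chart_img (c : chart_idx a) (p : M) : chart_dom c p ->
  \forall y \near chart c p,
    chart_dom c (chart_inv c y) /\ chart c (chart_inv c y) = y.
Proof.
move=> cp; have : nbhs (chart c p) (chart_img c).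
  by apply: open_nbhs_nbhs; split; [exact: sm_img_open|exists p].
by apply: filterS => _ [q cq <-]; rewrite (sm_invK hM).
Qed.

Lemma near_chart_inv (c d : chart_idx a) (p : M) : chart_dom c p ->
  chart_dom d p -> \forall y \near chart c p, chart_dom d (chart_inv c y).
Proof.
move=> cp dp; have := sm_inv_continuous hM (c := c).
rewrite continuous_open_subspace; last exact: sm_img_open.
move=> /(_ (chart c p)); rewrite inE => /(_ (ex_intro2 _ _ _ cp erefl)); apply.
rewrite (sm_invK hM) //; apply: open_nbhs_nbhs; split=> //; exact: sm_dom_open.
Qed.

Lemma transition_differentiable (c d : chart_idx a) (p : M) : chart_dom c p ->
  chart_dom d p -> differentiable (chart d \o chart_inv c) (chart c p).
Proof.
move=> cp dp; apply: differentiable_row => j.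
by apply: (@sm_transition _ _ _ _ hM c d j [::]); exists p.
Qed.

Lemma diff_chartK (c : chart_idx a) (p : M) (w : 'rV[R]_n) : chart_dom c p ->
  'd (chart c \o chart_inv c) (chart c p) w = w.
Proof.
by move=> cp; apply: diff_near_id; apply: filterS (near_chart_img cp) => y [].
Qed.

(** By the chain rule this is the differential of the composite of two inverse chart changes, which
    is the identity near [chart c p]. *)
Lemma tvecK (c : chart_idx a) (p : M) (w : 'rV[R]_n) : chart_dom c p ->
  tcoord c p (tvec c p w) = w.
Proof.
move=> cp; have ap := sm_cover hM p; rewrite /tcoord /tvec.
set c' := chart_at a p in ap *.
have E : (chart c' \o chart_inv c) (chart c p) = chart c' p.
  by rewrite /= (sm_invK hM).
have := @diff_comp R _ _ _ (chart c' \o chart_inv c) (chart c \o chart_inv c')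
  (chart c p) (transition_differentiable cp ap).
rewrite E => /(_ (transition_differentiable ap cp)) /(congr1 (@^~ w)) /= <-.
apply: diff_near_id.
near=> y; have [_ cy] : chart_dom c (chart_inv c y) /\ chart c (chart_inv c y) = y.
  by near: y; exact: near_chart_img.
have c'y : chart_dom c' (chart_inv c y) by near: y; exact: near_chart_inv.
by rewrite /= (sm_invK hM c'y) cy.
Unshelve. all: by end_near. Qed.

Lemma tvec_at (p : M) (w : 'rV[R]_n) : tvec (chart_at a p) p w = w.
Proof. exact/diff_chartK/sm_cover. Qed.

Lemma tcoord_at (p : M) (w : 'rV[R]_n) : tcoord (chart_at a p) p w = w.
Proof. exact/diff_chartK/sm_cover. Qed.

End Charts.

(** * Restriction of a Finsler metric to one tangent space *)

Section FiberwiseSmooth.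
Context {R : realType} (n : nat) (M : topologicalType) (a : atlas R n M).
Hypothesis hM : smooth_manifold a.

Lemma row_mx_differentiable m (y : 'rV[R]_m) (v : 'rV[R]_n) :
  differentiable (fun v => row_mx y v : 'rV[R]_(m + n)) v.
Proof.
apply: differentiable_row => j; case: (split_ordP j) => i ->.
  rewrite (_ : (fun _ => _) = cst (y 0 i)); first exact: differentiable_cst.
  by apply/funext => u; rewrite row_mxEl.
rewrite (_ : (fun _ => _) = fun u : 'rV[R]_n => u 0 i); first exact: differentiable_coord.
by apply/funext => u; rewrite row_mxEr.
Qed.

(** Moving [v] along a coordinate axis moves [row_mx y v] along the shifted axis; [derive_along]
    turns both partial derivatives into the same one-variable derivative. *)
Lemma iter_partial_row_mx m (y : 'rV[R]_m) (G : 'rV[R]_(m + n) -> R) s :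
  iter_partial s (fun v : 'rV[R]_n => G (row_mx y v)) =
  fun v => iter_partial (map (@rshift m n) s) G (row_mx y v).
Proof.
elim: s => //= i s ->; apply/funext => v; rewrite /partial.
have E t : row_mx y (v + t *: delta_mx 0 i) =
    row_mx y v + t *: delta_mx 0 (rshift m i) :> 'rV[R]_(m + n).
  by rewrite delta_mx_rshift scale_row_mx scaler0 add_row_mx addr0.
set g := iter_partial _ G.
have := @derive_along R _ _ (fun v => g (row_mx y v)) v (delta_mx 0 i) 0.
rewrite scale0r addr0 => <-.
have := @derive_along R _ _ g (row_mx y v) (delta_mx 0 (rshift m i)) 0.
rewrite scale0r addr0 => <-; congr (derive _ _ _).
by apply/funext => t; rewrite E.
Qed.

(** In the bundle chart over the preferred chart at [x], [F x] is the local expression of the metric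
    on the slice of constant base coordinates, since [tvec] is the identity there. *)
Lemma finsler_fiber_smooth (F : M -> 'rV[R]_n -> R) (x : M) :
  smooth_fun_on (tangent_atlas a) [set z | z.2 != 0] (fun z => F z.1 z.2) ->
  smooth_on [set v | v != 0] (F x).
Proof.
move=> Fs s v v0; have xc := sm_cover hM x.
pose G := (fun z => F z.1 z.2) \o chart_inv (chart_at a x : chart_idx (tangent_atlas a)).
have FE : F x = fun v => G (row_mx (chart (chart_at a x) x) v).
  by apply/funext => u; rewrite /G /= row_mxKl row_mxKr (sm_invK hM) // tvec_at.
rewrite FE iter_partial_row_mx.
apply: (differentiable_comp (row_mx_differentiable _ _)).
apply: Fs; exists (x, v); first by split.
by rewrite /= tcoord_at.
Qed.

End FiberwiseSmooth.

(** * The homogenized bundle *)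

Section Bundle.
Context {R : realType} (S : topologicalType) (a : atlas R 2 S).
Hypothesis hS : smooth_manifold a.
Local Notation HA := (H_atlas a).

Lemma Hproj_Hclass (x : S) (v : 'rV[R]_2) : Hproj (Hclass x v) = x.
Proof. by rewrite /Hclass; case: pselect. Qed.

(** [Hdir] chooses its representative, so only equality of rays is available. The unknown positive
    factor later drops out by homogeneity. *)
Lemma Hdir_Hclass (x : S) (v : 'rV[R]_2) : v != 0 ->
  exists2 r : R, 0 < r & Hdir (Hclass x v) = r *: v.
Proof.
move=> v0; have : (sval (Hclass x v)).2 = ray (Hdir (Hclass x v)).
  by rewrite /Hdir; case: cid2.
have -> : (sval (Hclass x v)).2 = ray v by rewrite /Hclass; case: pselect.
move=> rE; have : ray (Hdir (Hclass x v)) (Hdir (Hclass x v)).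
  by exists 1; rewrite ?scale1r /=.
by rewrite -rE => -[r r0 <-]; exists r.
Qed.

(** The base point of [Hclass] is right even at the zero vector, so the base block of a chart change
    depends on the base coordinates alone, for every [y]. *)
Lemma lsubmx_transition (k k' : chart_idx HA) (y : 'rV[R]_(2 + 1)) :
  lsubmx (chart k (chart_inv k' y)) = chart k.1.1 (chart_inv k'.1.1 (lsubmx y)).
Proof. by rewrite row_mxKl Hproj_Hclass. Qed.

Lemma lsubmx_chart (k : chart_idx HA) (h : HS R S) :
  lsubmx (chart k h) = chart k.1.1 (Hproj h).
Proof. by rewrite row_mxKl. Qed.

Lemma Hproj_inv (k : chart_idx HA) (y : 'rV[R]_(2 + 1)) :
  Hproj (chart_inv k y) = chart_inv k.1.1 (lsubmx y).
Proof. by rewrite Hproj_Hclass. Qed.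

Lemma lsubmx_diff (V : normedModType R) (f : V -> 'rV[R]_(2 + 1)) (x v : V) :
  differentiable f x -> lsubmx ('d f x v) = 'd (fun y => lsubmx (f y)) x v.
Proof.
move=> df; have dl := @differentiable_lsubmx R 1 2 1 (f x).
have -> : (fun y => lsubmx (f y)) = lsubmx \o f by [].
by rewrite (diff_comp df dl) /= diff_lin //; exact: continuous_lsubmx.
Qed.

(* No differentiability of the chart changes of [HS] is needed: where they fail
   to be differentiable, their ['d] is zero by convention. *)
Lemma transition_vertical (k k' : chart_idx HA) (p : S)
    (z u : 'rV[R]_(2 + 1)) : chart_dom k.1.1 p -> chart_dom k'.1.1 p ->
  lsubmx z = chart k'.1.1 p -> lsubmx u = 0 ->
  lsubmx ('d (chart k \o chart_inv k') z u) = 0.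
Proof.
move=> kp k'p zp u0.
have [df|ndf] := pselect (differentiable (chart k \o chart_inv k') z); last first.
  by rewrite diff_default // linear0.
rewrite lsubmx_diff //.
have -> : (fun y => lsubmx ((chart k \o chart_inv k') y)) =
    (chart k.1.1 \o chart_inv k'.1.1) \o lsubmx.
  by apply/funext => y; rewrite /comp lsubmx_transition.
have dl := @differentiable_lsubmx R 1 2 1 z.
have dt := transition_differentiable hS k'p kp; rewrite -zp in dt.
rewrite (diff_comp dl dt) /= diff_lin; first by rewrite /= u0 linear0.
exact: continuous_lsubmx.
Qed.

Lemma near_lsubmx (c : chart_idx a) (x : S) (z : 'rV[R]_(2 + 1)) :
  chart_dom c x -> lsubmx z = chart c x ->
  \forall y \near z, chart_dom c (chart_inv c (lsubmx y)) /\
                     chart c (chart_inv c (lsubmx y)) = lsubmx y.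
Proof.
move=> cx zx; have := near_chart_img hS cx; rewrite -zx.
exact: (@continuous_lsubmx R 1 2 1 z).
Qed.

(** The preferred chart at [h] is built over the preferred chart at [Hproj h], so in these charts
    the projection is [lsubmx] near [chart k h]. *)
Lemma tangent_map_Hproj (h : HS R S) (u : 'rV[R]_(2 + 1)) :
  tangent_map HA a (@Hproj R S) h u = lsubmx u.
Proof.
rewrite /tangent_map; set k := chart_at HA h.
have kh : chart_dom k.1.1 (Hproj h) by exact: sm_cover.
have dl := @differentiable_lsubmx R 1 2 1 (chart k h).
have E : \forall y \near chart k h,
    lsubmx y = (chart (chart_at a (Hproj h)) \o (@Hproj R S) \o chart_inv k) y.
  by near=> y; rewrite /comp Hproj_inv; have [_ ->] // :
    chart_dom k.1.1 (chart_inv k.1.1 (lsubmx y)) /\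
    chart k.1.1 (chart_inv k.1.1 (lsubmx y)) = lsubmx y;
  near: y; apply: near_lsubmx kh _; rewrite lsubmx_chart.
have [_ ->] := near_eq_diff E dl.
by rewrite diff_lin //; exact: continuous_lsubmx.
Unshelve. all: by end_near. Qed.

Lemma verticalP (h : HS R S) (y : 'rV[R]_(2 + 1)) :
  vertical a h y <-> lsubmx y = 0.
Proof. by rewrite /vertical tangent_map_Hproj. Qed.

Lemma hilbert_formE (F : S -> 'rV[R]_2 -> R) (h : HS R S) (u : 'rV[R]_(2 + 1)) :
  hilbert_form a F h u = 'D_(lsubmx u) (F (Hproj h)) (Hdir h).
Proof. by rewrite /hilbert_form tangent_map_Hproj. Qed.

(** [row_mx 0 1] is the coordinate vector d_s of the preferred chart. *)
Lemma vertical_fieldE (Y : HS R S -> 'rV[R]_(2 + 1)) h :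
  vertical_field a Y -> Y h = rsubmx (Y h) 0 0 *: row_mx 0 1.
Proof.
move=> [_ vY]; rewrite -[LHS]hsubmxK ((verticalP _ _).1 (vY h)).
rewrite scale_row_mx scaler0; congr row_mx.
by apply/rowP => i; rewrite !mxE ord1 mulr1n mulr1.
Qed.

Lemma tcoord_vertical (k : chart_idx HA) (h : HS R S) (u : 'rV[R]_(2 + 1)) :
  chart_dom k.1.1 (Hproj h) -> lsubmx u = 0 -> lsubmx (tcoord k h u) = 0.
Proof.
move=> kh u0; apply: (transition_vertical kh _ _ u0).
  exact: (sm_cover hS (Hproj h)).
by rewrite lsubmx_chart.
Qed.

Lemma tvec_vertical (k : chart_idx HA) (h : HS R S) (u : 'rV[R]_(2 + 1)) :
  chart_dom k.1.1 (Hproj h) -> lsubmx u = 0 -> lsubmx (tvec k h u) = 0.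
Proof.
move=> kh u0; apply: (transition_vertical _ kh _ u0).
  exact: (sm_cover hS (Hproj h)).
by rewrite lsubmx_chart.
Qed.

(** The Hilbert form kills the coordinate field [w] at all points near [h], so the term
    differentiating it in the direction [u] vanishes; only a derivative along the fiber remains. *)
Lemma ext_deriv_vertical (F : S -> 'rV[R]_2 -> R) (h : HS R S)
    (u w : 'rV[R]_(2 + 1)) : lsubmx w = 0 ->
  ext_deriv HA (hilbert_form a F) h u w =
  - 'D_w (form1_rep (hilbert_form a F) (chart_at HA h) u) (chart (chart_at HA h) h).
Proof.
move=> w0; rewrite /ext_deriv; set k := chart_at HA h.
have kh : chart_dom k.1.1 (Hproj h) by exact: (sm_cover hS (Hproj h)).
rewrite (@near_eq_derive _ _ _ (form1_rep _ k w) (cst 0)).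
  by rewrite derive_cst sub0r.
near=> y; rewrite /form1_rep hilbert_formE tvec_vertical ?derive0 //.
rewrite Hproj_inv.
have [] // : chart_dom k.1.1 (chart_inv k.1.1 (lsubmx y)) /\
  chart k.1.1 (chart_inv k.1.1 (lsubmx y)) = lsubmx y.
by near: y; apply: near_lsubmx kh _; rewrite lsubmx_chart.
Unshelve. all: by end_near. Qed.

Lemma smooth_vf_derivable (X : HS R S -> 'rV[R]_(2 + 1)) (k : chart_idx HA)
    (h : HS R S) (u : 'rV[R]_(2 + 1)) :
  smooth_vf HA X -> chart_dom k h -> derivable (vf_rep X k) (chart k h) u.
Proof.
move=> sX kh; apply: diff_derivable; apply: differentiable_row => j.
by apply: (sX k j [::]); exists h.
Qed.

Lemma lsubmx_derive (V : normedModType R) (f : V -> 'rV[R]_(2 + 1)) (x v : V) i :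
  derivable f x v -> lsubmx ('D_v f x) 0 i = 'D_v (fun y => lsubmx (f y) 0 i) x.
Proof.
move=> df; have -> : (fun y => lsubmx (f y) 0 i) = fun y => f y 0 (lshift 1 i).
  by apply/funext => y; rewrite mxE.
by rewrite mxE (derive_mx df) mxE.
Qed.

(** The base components of [Y] vanish identically near [h], which removes the derivative in the
    direction [X]. The base block is all that dA against a vertical vector sees of the bracket. *)
Lemma lsubmx_lie_bracket (X Y : HS R S -> 'rV[R]_(2 + 1)) (h : HS R S) i :
  chart_dom (chart_at HA h) h -> smooth_vf HA X -> vertical_field a Y ->
  lsubmx (lie_bracket HA X Y h) 0 i =
  - 'D_(Y h) (fun y => lsubmx (vf_rep X (chart_at HA h) y) 0 i)
             (chart (chart_at HA h) h).
Proof.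
move=> kh sX [sY vY]; rewrite /lie_bracket; set k := chart_at HA h.
have k1 : chart_dom k.1.1 (Hproj h) by exact: (sm_cover hS (Hproj h)).
rewrite linearB [LHS]mxE [X in _ + X]mxE.
rewrite !lsubmx_derive; try exact: smooth_vf_derivable.
rewrite (@near_eq_derive _ _ _ _ (cst 0)) ?derive_cst ?sub0r //.
near=> y; rewrite /vf_rep tcoord_vertical ?mxE //; last exact/verticalP.
rewrite Hproj_inv.
have [] // : chart_dom k.1.1 (chart_inv k.1.1 (lsubmx y)) /\
  chart k.1.1 (chart_inv k.1.1 (lsubmx y)) = lsubmx y.
by near: y; apply: near_lsubmx k1 _; rewrite lsubmx_chart.
Unshelve. all: by end_near. Qed.

(** * The two open half-fibers and their coordinate [s] *)

Section Fiber.
Variables (x : S) (b : bool).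
Let e : R := (-1) ^+ b.

Definition fiber_pt (s : R) : HS R S := Hclass x (vec e s).
Definition fiber_chart : chart_idx HA := (chart_at a x, ord0, b).
Definition fiber_coord (s : R) : 'rV[R]_(2 + 1) :=
  row_mx (chart (chart_at a x) x) (const_mx s).

Lemma Hproj_fiber_pt s : Hproj (fiber_pt s) = x.
Proof. exact: Hproj_Hclass. Qed.

Lemma Hdir_fiber_pt s : exists2 r : R, 0 < r & Hdir (fiber_pt s) = r *: vec e s.
Proof. exact/Hdir_Hclass/vec_neq0l. Qed.

Lemma sign_coord0 r s : 0 < r ->
  (r *: vec e s) 0 0 != 0 /\ ((r *: vec e s) 0 0 < 0) = b.
Proof.
move=> r0; rewrite !mxE /= mulf_neq0 ?signr_eq0 ?gt_eqF // pmulr_rlt0 //; split=> //.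
by rewrite /e; case: (b); rewrite ?expr1 ?expr0 ?ltrN10 // ltr10.
Qed.

(** The preferred chart is the same along the whole half-fiber, so components of vectors at
    different [s] refer to one frame and can be differentiated in [s]. *)
Lemma chart_at_fiber_pt s : chart_at HA (fiber_pt s) = fiber_chart.
Proof.
rewrite /= Hproj_fiber_pt; have [r r0 ->] := Hdir_fiber_pt s.
by have [/negPf -> ->] := sign_coord0 s r0.
Qed.

Lemma normalized_coord (r s : R) : 0 < r ->
  (r *: vec e s) 0 (rev_ord ord0) / (e * (r *: vec e s) 0 ord0) = s.
Proof.
move=> r0; rewrite !mxE /= mulrCA -expr2 /e sqrr_sign mulr1.
by rewrite mulrC mulKf // gt_eqF.
Qed.

Lemma chart_fiber_pt s : chart fiber_chart (fiber_pt s) = fiber_coord s.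
Proof.
rewrite /fiber_coord /= Hproj_fiber_pt tcoord_at //.
by have [r r0 ->] := Hdir_fiber_pt s; rewrite normalized_coord.
Qed.

Lemma chart_dom_fiber_pt s : chart_dom fiber_chart (fiber_pt s).
Proof.
rewrite /= Hproj_fiber_pt tcoord_at //; split; first exact: sm_cover.
have [r r0 ->] := Hdir_fiber_pt s.
by rewrite !mxE /= mulrCA -expr2 sqrr_sign mulr1.
Qed.

Lemma chart_inv_fiber_coord s : chart_inv fiber_chart (fiber_coord s) = fiber_pt s.
Proof.
rewrite /fiber_coord /= row_mxKl row_mxKr (sm_invK hS); last exact: sm_cover.
by rewrite tvec_at // mxE.
Qed.

Lemma fiber_coord_shift s t (w : 'rV[R]_(2 + 1)) : lsubmx w = 0 ->
  fiber_coord s + t *: w = fiber_coord (s + t * rsubmx w 0 0).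
Proof.
move=> w0; rewrite -[w]hsubmxK w0 scale_row_mx scaler0 add_row_mx addr0 row_mxKr.
by congr row_mx; apply/rowP => i; rewrite !mxE !ord1.
Qed.

(** The chart composed with its local inverse is computed near the point: the base block comes from
    the chart of [a], and the last coordinate is a ratio in which the factor left by [Hdir]
    cancels. *)
Lemma tcoord_fiber_pt s u : tcoord fiber_chart (fiber_pt s) u = u.
Proof.
rewrite /tcoord chart_at_fiber_pt chart_fiber_pt; apply: diff_near_id.
have cx : chart_dom (chart_at a x) x by exact: sm_cover.
near=> y.
have [cy cyE] : chart_dom (chart_at a x) (chart_inv (chart_at a x) (lsubmx y)) /\
    chart (chart_at a x) (chart_inv (chart_at a x) (lsubmx y)) = lsubmx y.
  by near: y; apply: near_lsubmx cx _; rewrite row_mxKl.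
rewrite /comp /= Hproj_Hclass cyE -[RHS]hsubmxK; congr row_mx.
set v := tvec _ _ _; set x' := chart_inv _ _ in cy v *.
have vE : tcoord (chart_at a x) x' v = vec e (rsubmx y 0 0).
  by rewrite tvecK //; apply/rowP => j; rewrite !mxE.
have v0 : v != 0.
  by apply: contra_eq_neq vE => ->; rewrite /tcoord linear0 eq_sym vec_neq0l.
have [r r0 ->] := Hdir_Hclass x' v0.
have -> : tcoord (chart_at a x) x' (r *: v) = r *: vec e (rsubmx y 0 0).
  by rewrite -vE /tcoord linearZ.
by rewrite normalized_coord //; apply/rowP => i; rewrite !mxE !ord1.
Unshelve. all: by end_near. Qed.

Lemma tvec_fiber_pt s u : tvec fiber_chart (fiber_pt s) u = u.
Proof. by have := tcoord_fiber_pt s u; rewrite /tcoord /tvec chart_at_fiber_pt. Qed.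

End Fiber.
End Bundle.

(** * Computations along a fiber *)

Section Homogeneous.
Context {R : realType} (N : 'rV[R]_2 -> R).
Hypothesis N_homo : forall l v, 0 < l -> N (l *: v) = l * N v.

(** With [g t = N (v + t *: u)] one has [N (r *: v + t *: u) = r * g (t / r)], and the factors [r]
    and [1 / r] cancel. Hence the Hilbert form is insensitive to the representative [Hdir]. *)
Lemma derive_homogeneous (v u : 'rV[R]_2) (r : R) : 0 < r ->
  differentiable N v -> 'D_u N (r *: v) = 'D_u N v.
Proof.
move=> r0 dv; pose g t := N (v + t *: u).
have dg : is_derive (0 : R) (1 : R) g ('D_u N v).
  by have := @is_derive_along R _ _ N v u 0; rewrite scale0r addr0; apply.
have := @derive_along R _ _ N (r *: v) u 0; rewrite scale0r addr0 => <-.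
have -> : (fun t : R => N (r *: v + t *: u)) = fun t => r * g (r^-1 * t).
  apply/funext => t; rewrite /g -N_homo // scalerDr scalerA mulrA divff ?gt_eqF //.
  by rewrite mul1r.
have dl : is_derive (0 : R) (1 : R) (fun t => r^-1 * t) r^-1.
  by apply: is_derive_eq; rewrite /GRing.scale /=; ring.
have dc : is_derive (0 : R) (1 : R) (fun t => g (r^-1 * t)) ('D_u N v * r^-1).
  apply: DeriveDef.
    apply/derivable1_diffP.
    apply: (@differentiable_comp _ _ _ _ (fun t => r^-1 * t) g);
      apply/derivable1_diffP => //.
    by rewrite mulr0.
  rewrite -derive1E (@derive1_comp _ (fun t => r^-1 * t) g) ?mulr0 //.
  by rewrite !derive1E !derive_val.
rewrite derive_val /GRing.scale /=; field; exact: lt0r_neq0.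
Qed.

(** Near [t = 0] homogeneity makes [N (v + t *: v)] equal to the affine function [(1 + t) * N v]. *)
Lemma euler_homogeneous (v : 'rV[R]_2) : 'D_v N v = N v.
Proof.
have := @derive_along R _ _ N v v 0; rewrite scale0r addr0 => <-.
rewrite (@near_eq_derive _ _ _ (fun t : R => N (v + t *: v))
  (fun t : R => N v + t * N v)).
  by rewrite derive_val /GRing.scale /=; ring.
near=> t; have t0 : 0 < 1 + t.
  by rewrite -ltrBlDl sub0r; near: t; apply: lt_nbhsr; rewrite oppr_lt0.
by rewrite -[X in X + t *: _]scale1r -scalerDl N_homo // mulrDl mul1r.
Unshelve. all: by end_near. Qed.

Lemma derive_vec (u v : 'rV[R]_2) : differentiable N v ->
  'D_u N v = u 0 0 * partial 0 N v + u 0 1 * partial 1 N v.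
Proof.
move=> dN; rewrite /partial !deriveE // {1}[u]vec_eta.
have -> : vec (u 0 0) (u 0 1) = u 0 0 *: delta_mx 0 0 + u 0 1 *: delta_mx 0 1.
  by rewrite delta_vec0 delta_vec1 !vecZ vecD !mulr0 !mulr1 addr0 add0r.
by rewrite linearD !linearZ.
Qed.

End Homogeneous.

(** * Hilbert form, Reeb field, vertical metric and angle form in the coordinate [s] *)

Section FiberForms.
Context {R : realType} (S : topologicalType) (a : atlas R 2 S).
Hypothesis hS : smooth_manifold a.
Variables (F : S -> 'rV[R]_2 -> R) (hF : finsler_metric a F) (x : S) (b : bool).
Local Notation HA := (H_atlas a).
Local Notation A := (hilbert_form a F).
Local Notation h := (fiber_pt x b).
Let e : R := (-1) ^+ b.
Let f s : R := F x (vec e s).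
Let q s : R := partial 1 (F x) (vec e s).
Let p s : R := partial 0 (F x) (vec e s).
Let q' s : R := partial 1 (partial 1 (F x)) (vec e s).

Let F_smooth : smooth_on [set v | v != 0] (F x).
Proof. exact: (finsler_fiber_smooth hS x (fm_smooth hF)). Qed.

Let ve s : [set v : 'rV[R]_2 | v != 0] (vec e s). Proof. exact: vec_neq0l. Qed.

Let ee : e * e = 1. Proof. by rewrite -expr2; exact: sqrr_sign. Qed.

Let df s : is_derive s (1 : R) f (q s).
Proof. exact: (is_derive_vecr (F_smooth [::] (ve s))). Qed.

Let dq s : is_derive s (1 : R) q (q' s).
Proof. exact: (is_derive_vecr (F_smooth [:: 1] (ve s))). Qed.

Lemma fiber_gt0 s : 0 < f s.
Proof.
rewrite lt_neqAle (fm_ge0 hF) andbT eq_sym; apply/eqP => /(fm_eq0 hF)/eqP.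
exact/negP/vec_neq0l.
Qed.

Lemma fiber_euler s : f s = e * p s + s * q s.
Proof.
rewrite /f -[LHS](euler_homogeneous (fm_homogeneous hF x)) derive_vec ?mxE //.
exact: (F_smooth [::]).
Qed.

(** Euler's relation gives [p = e * (f - s * q)], whose derivative involves only [q']; this bypasses
    the mixed partial derivative. *)
Lemma is_derive_p s : is_derive s (1 : R) p (- (e * s * q' s)).
Proof.
rewrite (_ : p = fun s => e * (f s - s * q s)).
  have df1 := df s; have dq1 := dq s.
  by apply: is_derive_eq; rewrite /GRing.scale /=; ring.
by apply/funext => t; rewrite fiber_euler addrK mulrA ee mul1r.
Qed.

Lemma hilbert_form_fiber_pt s (u : 'rV[R]_(2 + 1)) :
  A (h s) u = lsubmx u 0 0 * p s + lsubmx u 0 1 * q s.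
Proof.
rewrite hilbert_formE // Hproj_fiber_pt.
have [r r0 ->] := Hdir_fiber_pt x b s.
have dF v : v != 0 -> differentiable (F x) v by exact: (F_smooth [::]).
rewrite derive_homogeneous ?derive_vec //; try exact: (fm_homogeneous hF).
all: exact/dF/vec_neq0l.
Qed.

(** Along a vertical [w] the point moves on the coordinate line of [s] with speed [rsubmx w 0 0], so
    only the values of [g] on that line matter. *)
Lemma derive_fiber (g : 'rV[R]_(2 + 1) -> R) (g1 : R -> R) (d : R) s
    (w : 'rV[R]_(2 + 1)) : lsubmx w = 0 -> (forall t, g (fiber_coord a x t) = g1 t) ->
  is_derive s (1 : R) g1 d ->
  'D_w g (fiber_coord a x s) = rsubmx w 0 0 * d.
Proof.
move=> w0 gE dg.
have := @derive_along R _ _ g (fiber_coord a x s) w 0; rewrite scale0r addr0 => <-.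
have -> : (fun t : R => g (fiber_coord a x s + t *: w)) =
    g1 \o (fun t => s + t * rsubmx w 0 0).
  by apply/funext => t; rewrite fiber_coord_shift.
have dl : is_derive (0 : R) (1 : R) (fun t => s + t * rsubmx w 0 0) (rsubmx w 0 0).
  by apply: is_derive_eq; rewrite /GRing.scale /=; ring.
rewrite -derive1E derive1_comp //; last by rewrite mul0r addr0.
by rewrite !derive1E mul0r addr0 !derive_val mulrC.
Qed.

Lemma ext_deriv_fiber_pt s (u w : 'rV[R]_(2 + 1)) : lsubmx w = 0 ->
  ext_deriv HA A (h s) u w =
  - rsubmx w 0 0 * q' s * (lsubmx u 0 1 - e * s * lsubmx u 0 0).
Proof.
move=> w0; rewrite ext_deriv_vertical // chart_at_fiber_pt chart_fiber_pt //.
have dA : is_derive s (1 : R) (fun t => lsubmx u 0 0 * p t + lsubmx u 0 1 * q t)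
    (q' s * (lsubmx u 0 1 - e * s * lsubmx u 0 0)).
  have dp := is_derive_p s; have dq1 := dq s.
  by apply: is_derive_eq; rewrite /GRing.scale /=; ring.
rewrite (derive_fiber w0 _ dA); first by rewrite !mulNr mulrA.
move=> t; rewrite /form1_rep chart_inv_fiber_coord // tvec_fiber_pt //.
exact: hilbert_form_fiber_pt.
Qed.

(** Pairing i_X dA = 0 with d_s makes the base part of [X] proportional to [(e, s)], as [q'] is
    nonzero. Then A(X) = 1 and Euler's relation give the factor [1 / f]. *)
Lemma reeb_fiber_pt (X : HS R S -> 'rV[R]_(2 + 1)) s : reeb_field a F X ->
  q' s != 0 -> lsubmx (X (h s)) 0 0 = e / f s /\ lsubmx (X (h s)) 0 1 = s / f s.
Proof.
move=> [_ /(_ (h s)) X1 /(_ (h s) (row_mx 0 1)) X2] q0.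
move: X2; rewrite ext_deriv_fiber_pt ?row_mxKl // row_mxKr mxE mulr1n mulN1r => /eqP.
rewrite mulf_eq0 oppr_eq0 (negPf q0) /= subr_eq0 => /eqP Xs.
move: X1; rewrite hilbert_form_fiber_pt Xs => X1.
have f0 := gt_eqF (fiber_gt0 s).
have X0 : lsubmx (X (h s)) 0 0 = e / f s.
  apply: (mulIf (negbT f0)); rewrite divfK ?f0 // -[RHS]mulr1 -X1 fiber_euler.
  by ring: ee.
by rewrite X0; split=> //; rewrite mulrA; congr (_ * _); ring: ee.
Qed.

(** The base part of [[X, Y]] is minus the s-component of [Y] times the derivative of [(e, s) / f];
    once inserted in dA, the terms in [q] cancel. Since the Reeb components get differentiated, [q']
    must be nonzero along the whole half-fiber. *)
Lemma vertical_metric_fiber_pt (X Y : HS R S -> 'rV[R]_(2 + 1)) g s :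
  reeb_field a F X -> vertical_metric a F X g -> vertical_field a Y ->
  (forall t, q' t != 0) -> 
  g (h s) (Y (h s)) (Y (h s)) = rsubmx (Y (h s)) 0 0 ^+ 2 * q' s / f s.
Proof.
move=> hX hg [sY vY] q0; rewrite (hg _ _ _ _ _ Y Y) //.
have w0 : lsubmx (Y (h s)) = 0 by exact: ((verticalP hS _ _).1 (vY (h s))).
have [sX _ _] := hX.
have f0 t : f t != 0 by rewrite gt_eqF ?fiber_gt0.
rewrite ext_deriv_fiber_pt // !lsubmx_lie_bracket //;
  try by rewrite chart_at_fiber_pt; exact: chart_dom_fiber_pt.
rewrite chart_at_fiber_pt chart_fiber_pt //.
have df1 := df s; have fs0 := f0 s.
have dX0 : is_derive s (1 : R) (fun t => e * (f t)^-1) (- (e * q s / f s ^+ 2)).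
  by apply: is_derive_eq; rewrite /GRing.scale /=; field.
have dX1 : is_derive s (1 : R) (fun t => t * (f t)^-1) ((f s - s * q s) / f s ^+ 2).
  by apply: is_derive_eq; rewrite /GRing.scale /=; field.
pose Xc i y := lsubmx (vf_rep X (fiber_chart a x b) y) 0 i.
have XcE i t : Xc i (fiber_coord a x t) = lsubmx (X (h t)) 0 i.
  by rewrite /Xc /vf_rep chart_inv_fiber_coord // tcoord_fiber_pt.
rewrite (derive_fiber (g := Xc 0) w0 _ dX0); last first.
  by move=> t; rewrite XcE; case: (reeb_fiber_pt hX (q0 t)).
rewrite (derive_fiber (g := Xc 1) w0 _ dX1); last first.
  by move=> t; rewrite XcE; case: (reeb_fiber_pt hX (q0 t)).
by field: ee.
Qed.

(** dA against a vertical vector carries the factor [q'], so a vertical vector of length 1 excludes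
    [q' s = 0]. *)
Lemma fiber_derive2_neq0 (X Y : HS R S -> 'rV[R]_(2 + 1)) g s :
  vertical_metric a F X g -> vertical_field a Y ->
  g (h s) (Y (h s)) (Y (h s)) = 1 -> q' s != 0.
Proof.
move=> hg hY; have [_ vY] := hY; rewrite (hg _ _ _ _ _ Y Y) //.
rewrite ext_deriv_fiber_pt; last exact: ((verticalP hS _ _).1 (vY (h s))).
by apply: contra_eq_neq => ->; rewrite mulr0 mul0r eq_sym oner_eq0.
Qed.

(** The wedge relation is evaluated on d_1, d_2, d_s. As d_s projects to 0, one term survives on the
    left; on the right Euler's relation gathers [p] and [q] into [f]. *)
Lemma angle_form_fiber_pt o alpha Om s :
  angle_form a o F alpha Om ->
  alpha (h s) (row_mx 0 1) * Om x (vec 1 0) (vec 0 1) = - (e * q' s * f s).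
Proof.
move=> hal; have [Olin Oanti _] := (af_volume hal).1.
have Ol0 u : Om x 0 u = 0.
  have := Olin x 1 0 0 u; rewrite scaler0 addr0 mul1r => /esym/eqP.
  by rewrite -subr_eq0 addrK => /eqP.
have Or0 u : Om x u 0 = 0 by rewrite Oanti Ol0 oppr0.
have := af_wedge hal (h s) (row_mx (vec 1 0) 0) (row_mx (vec 0 1) 0) (row_mx 0 1).
rewrite /wedge12 /pullback2 !tangent_map_Hproj // Hproj_fiber_pt !row_mxKl.
rewrite !Or0 !mulr0 subr0 add0r => ->.
rewrite !hilbert_form_fiber_pt !row_mxKl !mxE /= !(mul0r, addr0).
rewrite !ext_deriv_fiber_pt ?row_mxKl // !row_mxKr !mxE /=.
have := fiber_euler s; move: (f s) (p s) (q s) (q' s) => f0 p0 q0 q1 ->.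
by ring: ee.
Qed.

End FiberForms.

(** * From the two normalizations to the equation f^3 f'' = (c w)^2 *)

Theorem proposition1p4p1 (R : realType)
  (Sigma : topologicalType) (a : atlas R 2 Sigma) (hS : smooth_manifold a)
  (o : Sigma -> bool) (ho : orientation a o)
  (F : Sigma -> 'rV[R]_2 -> R) (hF : finsler_metric a F)
  (X : HS R Sigma -> 'rV[R]_(2 + 1)) (hX : reeb_field a F X)
  (alpha : HS R Sigma -> 'rV[R]_(2 + 1) -> R)
  (Om : Sigma -> 'rV[R]_2 -> 'rV[R]_2 -> R) (halpha : angle_form a o F alpha Om)
  (g : HS R Sigma -> 'rV[R]_(2 + 1) -> 'rV[R]_(2 + 1) -> R)
  (hg : vertical_metric a F X g)
  (Y : HS R Sigma -> 'rV[R]_(2 + 1)) (hY : vertical_field a Y)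
  (halphaY : forall h : HS R Sigma, alpha h (Y h) = 1)
  (Y' : HS R Sigma -> 'rV[R]_(2 + 1)) (hY' : vertical_field a Y')
  (hgY' : forall h : HS R Sigma, g h (Y' h) (Y' h) = 1)
  (c : HS R Sigma -> R) (hc : forall h : HS R Sigma, Y' h = c h *: Y h)
  (hconst : forall h1 h2 : HS R Sigma, Hproj h1 = Hproj h2 -> c h1 = c h2) :
  riemannian F.
Proof.
move=> x; pose om := Om x (vec 1 0) (vec 0 1).
(* Any point over [x] would do; since [c] is constant on the fiber, one constant serves both
   half-planes. *)
pose cx := c (fiber_pt x false 0).
apply: (@norm_quadratic_form R (F x) (fun=> (cx * om) ^+ 2)).
- exact: (fm_homogeneous hF x).
- exact/(fm_eq0 hF).
- move=> v v0; rewrite lt_neqAle (fm_ge0 hF) andbT eq_sym.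
  by apply/eqP => /(fm_eq0 hF)/eqP; exact/negP.
- exact: (finsler_fiber_smooth hS x (fm_smooth hF)).
move=> b s; set h := fiber_pt x b s.
have q0 t := fiber_derive2_neq0 (x := x) (b := b) (s := t) hS hF hg hY' (hgY' _).
have := vertical_metric_fiber_pt hS hF s hX hg hY' q0; rewrite hgY' -/h.
have := angle_form_fiber_pt hS hF x b s halpha; rewrite -/h -/om.
have := halphaY h; rewrite (vertical_fieldE hS h hY).
have := (af_form halpha).1 h.
have -> : rsubmx (Y' h) 0 0 = cx * rsubmx (Y h) 0 0.
  rewrite hc linearZ mxE; congr (_ * _).
  by apply: hconst; rewrite !Hproj_fiber_pt.
have f0 := fiber_gt0 hF x b s.
set phi := rsubmx (Y h) 0 0 => alin.
have al0 : alpha h 0 = 0.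
  have := alin 1 0 0; rewrite scaler0 addr0 mul1r => /esym/eqP.
  by rewrite -subr_eq0 addrK => /eqP.
have -> : alpha h (phi *: row_mx 0 1) = phi * alpha h (row_mx 0 1).
  by have := alin phi (row_mx 0 1) 0; rewrite al0 !addr0.
move: f0; set q1 := partial 1 _ _; set f := F x _; set al := alpha h _.
move=> f0 alphi alom gE.
(* alpha(Y) = 1 reads [phi * al = 1], which eliminates [al] from the angle form relation. *)
have omE : om = - (phi * (-1) ^+ b * q1 * f).
  by transitivity (phi * al * om); [rewrite alphi mul1r|rewrite -mulrA alom; ring].
have e2 : (-1 : R) ^+ b ^+ 2 = 1 by exact: sqrr_sign.
(* This is g(Y', Y') = 1, where [cx * phi] is the s-component of [Y']. *)
have fE : f = (cx * phi) ^+ 2 * q1.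
  by apply: (mulIf (invr_neq0 (lt0r_neq0 f0))); rewrite -gE divff // lt0r_neq0.
(* The square is grouped so that [fE] absorbs [phi] and leaves [f * (q1 * f ^+ 2)]. *)
rewrite omE (_ : (cx * _) ^+ 2 = (cx * phi) ^+ 2 * q1 * ((-1) ^+ b ^+ 2 * q1 * f ^+ 2)).
  by rewrite -fE e2; ring.
by ring.
Qed.
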